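(* Let $\tau$ be an rp-tree with $n$ leaves. The cooperad structure map $g_\tau$ passes from $\Delta_n$ and $o\Delta_n$ to their quotients $\mathrm{Siop}(n)=\Delta_n/I_n$ and $\mathrm{Siop}^o(n)=o\Delta_n/oI_n$ respectively; that is, $g_\tau$ induces well-defined maps $\mathrm{Siop}(n)\to\bigotimes_{v_i}\mathrm{Siop}(|v_i|)$ and $\mathrm{Siop}^o(n)\to\bigotimes_{v_i}\mathrm{Siop}^o(|v_i|)$, where $v_i$ ranges over the internal vertices of $\tau$.
   Context: Fix a commutative ground ring $R$; write $\mathbf n=\{1,\dots,n\}$. Diagrams. A Diagram is a finite, possibly disconnected, oriented graph with vertices labeled bijectively by $\mathbf n$; an oDiagram is a finite, possibly disconnected, unoriented graph with vertices labeled bijectively by $\mathbf n$ and a total ordering of its edges. Each edge joins distinct vertices; multiple edges are allowed. $\Delta_n$ and $o\Delta_n$ are the free $R$-modules on Diagrams and oDiagrams. Relations. $I_n\subset\Delta_n$ is the submodule generated by: Arnold combinations (sums of three Diagrams differing only in two edges among three distinct vertices $i,j,k$, these being respectively $\{i\to j,j\to k\}$, $\{j\to k,k\to i\}$, $\{k\to i,i\to j\}$); symmetry combinations (sums of two Diagrams differing in the orientation of exactly one edge); and Diagrams with two edges having the same pair of endpoints. $oI_n\subset o\Delta_n$ is the submodule generated by: Arnold combinations (sums of three oDiagrams differing only in two edges among three distinct vertices $i,j,k$, the two edges being ordered consecutively and in the same position in all three, first I then II, with (I,II) respectively $(ij,jk)$, $(jk,ki)$, $(ki,ij)$); symmetry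 combinations $D-\mathrm{sign}(\pi)D'$, where $D,D'$ differ only in the ordering of edges and $\pi$ is the permutation relating the orderings; and oDiagrams with two edges having the same pair of endpoints. rp-trees. An rp-tree is a rooted planar tree in the upper half-plane with a root edge, whose internal vertices may have any positive number of branches; for an internal vertex $v$, $|v|$ is its valence minus one, i.e. its number of branches. Label the leaves of $\tau$ by $1,\dots,n$ and the branches of each internal vertex $v$ by $1,\dots,|v|$, from left to right. Fix an ordering of the internal vertices of $\tau$, used in all tensor products. The map $g_\tau$. For distinct $j,k\in\mathbf n$ let $v$ be the nadir (vertex closest to the root) of the shortest path in $\tau$ between leaves $j$ and $k$, and let $J_v(j),J_v(k)$ be the labels of the branches of $v$ over which leaves $j$ and $k$ lie. $D_v$ is the graph on vertices $\{1,\dots,|v|\}$ having, for each edge of $D$ between $j$ and $k$ whose associated nadir is $v$, an edge between $J_v(j)$ and $J_v(k)$ (oriented from $J_v(j)$ to $J_v(k)$ if the edge is $j\to k$; respectively, with edges ordered as the edges of $D$ giving rise to them). On $\Delta_n$, $g_\tau(D)=\bigotimes_{v_i}D_{v_i}\in\bigotimes_{v_i}\Delta_{|v_i|}$; on $o\Delta_n$, $g_\tau(D)=\mathrm{sign}(\pi)\bigotimes_{v_i}D_{v_i}\in\bigotimes_{v_i}o\Delta_{|v_i|}$, where $\pi$ is the permutation relating the order of all edges in $\bigotimes_{v_i}D_{v_i}$ (concatenating factors) to their order within $D$. Extend linearly. *)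

(* Defs.v *)
From HB Require Import structures.
From mathcomp Require Import all_boot all_order all_fingroup all_algebra.
From mathcomp Require Import generic_quotient ring_quotient.
From mathcomp Require Import finmap multiset.
From mathcomp Require Import monalg.
From mathcomp Require Import boolp.

Set Implicit Arguments.
Unset Strict Implicit.
Unset Printing Implicit Defensive.

Import GRing.Theory Quotient.

Local Open Scope ring_scope.
Local Open Scope quotient_scope.
Local Open Scope mset_scope.

(* MathComp-multinomials makes {malg R[K]} an R-module only for nontrivial R;
   this alias carries the module structure over any commutative ring. *)
Definition freemod (R : comPzRingType) (K : choiceType) := {malg R[K]}.
HB.instance Definition _ R K := GRing.Zmodule.on (freemod R K).

Section FreeModule.
Variables (R : comPzRingType) (K : choiceType).
Implicit Types (g : freemod R K).

Definition fm_gen (k : K) : freemod R K := mkmalgU k 1.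

Definition fm_scale (c : R) g : freemod R K := [malg k in msupp g => c * g@_k].

Lemma fm_scaleE c g k : (fm_scale c g)@_k = c * g@_k.
Proof. by rewrite mcoeffE; case: msuppP; rewrite ?mulr0. Qed.

Fact fm_scaleA a b g : fm_scale a (fm_scale b g) = fm_scale (a * b) g.
Proof. by apply/malgP=> k; rewrite !fm_scaleE mulrA. Qed.

Fact fm_scale1 g : fm_scale 1 g = g.
Proof. by apply/malgP=> k; rewrite fm_scaleE mul1r. Qed.

Fact fm_scaleDr a g h : fm_scale a (g + h) = fm_scale a g + fm_scale a h.
Proof. by apply/malgP=> k; rewrite !(mcoeffD, fm_scaleE) mulrDr. Qed.

Fact fm_scaleDl g a b : fm_scale (a + b) g = fm_scale a g + fm_scale b g.
Proof. by apply/malgP=> k; rewrite !(mcoeffD, fm_scaleE) mulrDl. Qed.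

HB.instance Definition _ := GRing.Zmodule_isLmodule.Build R (freemod R K)
  fm_scaleA fm_scale1 fm_scaleDr fm_scaleDl.

Lemma mcoeff_fmZ c g k : (c *: g)@_k = c * g@_k.
Proof. exact: fm_scaleE. Qed.

Variables (V : lmodType R) (f : K -> V).

Definition fm_lift g : V := \sum_(k <- msupp g) g@_k *: f k.

Lemma fm_liftEw g (d : {fset K}) : (msupp g `<=` d)%fset ->
  fm_lift g = \sum_(k <- d) g@_k *: f k.
Proof.
move=> le_gd; apply: big_fset_incl => // k _ /mcoeff_outdom ->.
by rewrite scale0r.
Qed.

Fact fm_lift_linear : linear fm_lift.
Proof.
move=> a g h; set d := (msupp g `|` (msupp h `|` msupp (a *: g + h)%R))%fset.
rewrite (@fm_liftEw g d) ?(@fm_liftEw h d) ?(@fm_liftEw (a *: g + h) d);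
  try by apply/fsubsetP=> k; rewrite !inE => ->; rewrite ?orbT.
rewrite scaler_sumr -big_split /=; apply: eq_bigr => k _.
by rewrite mcoeffD mcoeff_fmZ scalerDl scalerA.
Qed.

HB.instance Definition _ :=
  GRing.isLinear.Build R (freemod R K) V *:%R fm_lift fm_lift_linear.

Lemma fm_lift_gen k : fm_lift (fm_gen k) = f k.
Proof.
by rewrite (fm_liftEw msuppU_le) big_seq_fset1 mcoeffUU scale1r.
Qed.

End FreeModule.

Lemma fm_genE (R : comPzRingType) (K : choiceType) (g : freemod R K) :
  g = \sum_(k <- msupp g) g@_k *: fm_gen R k.
Proof.
rewrite {1}(monalgE (g : {malg R[K]})); apply: eq_bigr => k _.
apply/malgP => k'; rewrite mcoeff_fmZ /fm_gen !mcoeffU.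
by case: eqP; rewrite ?mulr1n ?mulr0n ?mulr1 ?mulr0.
Qed.

Section Span.
Variables (R : comPzRingType) (V : lmodType R) (S : V -> Prop).

Definition in_span (v : V) : Prop :=
  exists (m : nat) (c : 'I_m -> R) (s : 'I_m -> V),
    (forall i, S (s i)) /\ v = \sum_i c i *: s i.

Definition span : V -> bool := fun v => `[< in_span v >].

Fact span_submod_closed : submod_closed (span : {pred V}).
Proof.
split=> [|a u v].
  apply/asboolP; exists 0%N, (fun=> 0), (fun=> 0).
  by split=> [[]//|]; rewrite big_ord0.
move=> /asboolP [m [c [s [Ss ->]]]] /asboolP [p [d [t [St ->]]]].
apply/asboolP; exists (m + p)%N.
exists (fun i => match split i with inl j => a * c j | inr j => d j end).
exists (fun i => match split i with inl j => s j | inr j => t j end).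
split=> [i|]; first by case: (split i).
rewrite big_split_ord /= scaler_sumr; congr (_ + _); apply: eq_bigr => i _.
  by rewrite (unsplitK (inl i)) scalerA.
by rewrite (unsplitK (inr i)).
Qed.

HB.instance Definition _ := GRing.isSubmodClosed.Build R V span
  span_submod_closed.

Lemma span_gen v : S v -> v \in (span : {pred V}).
Proof.
move=> Sv; apply/asboolP; exists 1%N, (fun=> 1), (fun=> v).
by rewrite big_ord1 scale1r.
Qed.

Definition quotm := quot (GRing.ZmodClosed.clone V span _).
HB.instance Definition _ := GRing.Zmodule.on quotm.

Definition quotm_pi (v : V) : quotm := \pi_quotm v.

Lemma quotm_piP v w : quotm_pi v = quotm_pi w <-> v - w \in (span : {pred V}).
Proof.
by rewrite /quotm_pi; split=> [/eqP|?]; [|apply/eqP]; rewrite -idealrBE.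
Qed.

Lemma quotm_piD v w : quotm_pi (v + w) = quotm_pi v + quotm_pi w.
Proof. by rewrite /quotm_pi raddfD. Qed.

Lemma quotm_repr (q : quotm) : quotm_pi (repr q) = q.
Proof. exact: reprK. Qed.

Definition quotm_scale (a : R) (q : quotm) : quotm := quotm_pi (a *: repr q).

Lemma quotm_scale_pi a v : quotm_scale a (quotm_pi v) = quotm_pi (a *: v).
Proof.
by apply/quotm_piP; rewrite -scalerBr rpredZ //; apply/quotm_piP/quotm_repr.
Qed.

Fact quotm_scaleA a b q :
  quotm_scale a (quotm_scale b q) = quotm_scale (a * b) q.
Proof. by rewrite -[q]quotm_repr !quotm_scale_pi scalerA. Qed.

Fact quotm_scale1 q : quotm_scale 1 q = q.
Proof. by rewrite -[q]quotm_repr quotm_scale_pi scale1r. Qed.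

Fact quotm_scaleDr a q r :
  quotm_scale a (q + r) = quotm_scale a q + quotm_scale a r.
Proof.
rewrite -[q]quotm_repr -[r]quotm_repr -quotm_piD !quotm_scale_pi.
by rewrite scalerDr quotm_piD.
Qed.

Fact quotm_scaleDl q a b :
  quotm_scale (a + b) q = quotm_scale a q + quotm_scale b q.
Proof. by rewrite -[q]quotm_repr !quotm_scale_pi scalerDl quotm_piD. Qed.

HB.instance Definition _ := GRing.Zmodule_isLmodule.Build R quotm
  quotm_scaleA quotm_scale1 quotm_scaleDr quotm_scaleDl.

Fact quotm_pi_linear : linear quotm_pi.
Proof. by move=> a v w; rewrite quotm_piD -quotm_scale_pi. Qed.

HB.instance Definition _ :=
  GRing.isLinear.Build R V quotm *:%R quotm_pi quotm_pi_linear.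

Section Lift.
Variables (W : lmodType R) (f : {linear V -> W}).
Hypothesis f0 : forall v, S v -> f v = 0.

Lemma linear_span0 v : v \in (span : {pred V}) -> f v = 0.
Proof.
move=> /asboolP [m [c [s [Ss ->]]]]; rewrite linear_sum big1 // => i _.
by rewrite linearZ /= f0 // scaler0.
Qed.

Lemma linear_repr v : f (repr (quotm_pi v)) = f v.
Proof.
apply/eqP; rewrite -subr_eq0 -linearB; apply/eqP/linear_span0.
exact/quotm_piP/quotm_repr.
Qed.

End Lift.
End Span.

Section Tensor.
Variables (R : comPzRingType) (I : finType).

Inductive tens_rel (M : I -> lmodType R) :
    freemod R (forall i, M i) -> Prop :=
| TensRel (x : forall i, M i) (i : I) (a : R) (u v : M i) :
    tens_rel (fm_gen R (dfwith x (a *: u + v))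
              - (a *: fm_gen R (dfwith x u) + fm_gen R (dfwith x v))).

Definition tensor (M : I -> lmodType R) : lmodType R := quotm (@tens_rel M).

Definition tens (M : I -> lmodType R) (x : forall i, M i) : tensor M :=
  quotm_pi (@tens_rel M) (fm_gen R x).

Lemma tens_linear (M : I -> lmodType R) (x : forall i, M i) i a (u v : M i) :
  tens (dfwith x (a *: u + v)) = a *: tens (dfwith x u) + tens (dfwith x v).
Proof.
by rewrite /tens -linearP; apply/quotm_piP/span_gen; constructor.
Qed.

Variables (M N : I -> lmodType R) (f : forall i, {linear M i -> N i}).

Let tmap (x : forall i, M i) : tensor N := tens (fun i => f i (x i)).

Definition tensor_map (t : tensor M) : tensor N := fm_lift tmap (repr t).

Let tmap0 g : tens_rel (M := M) g -> fm_lift tmap g = 0.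
Proof.
case=> x i a u v; rewrite linearB linearP /= !fm_lift_gen /tmap.
have E w : (fun j => f j (dfwith x w j)) = dfwith (fun j => f j (x j)) (f i w).
  apply: functional_extensionality_dep => j.
  by case: (eqVneq i j) => [<-|ij]; rewrite ?dfwith_in // !dfwith_out.
by rewrite !E linearP tens_linear subrr.
Qed.

Lemma tensor_map_tens x : tensor_map (tens x) = tens (fun i => f i (x i)).
Proof. by rewrite /tensor_map (linear_repr tmap0) /= fm_lift_gen. Qed.

Fact tensor_map_linear : linear tensor_map.
Proof.
move=> a s t; rewrite /tensor_map -[s in LHS]quotm_repr -[t in LHS]quotm_repr.
by rewrite -!linearP !(linear_repr tmap0) linearP.
Qed.

HB.instance Definition _ :=
  GRing.isLinear.Build R (tensor M) (tensor N) *:%R tensor_map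
    tensor_map_linear.

End Tensor.

(* Edges carry no labels, so a graph on n labeled vertices is the multiset of its
   edges, and one with totally ordered edges is the sequence of its edges. *)
Definition edge (n : nat) := {e : 'I_n * 'I_n | e.1 != e.2}.
Definition diagram (n : nat) := {mset edge n}.

Definition oedge (n : nat) := {e : {set 'I_n} | #|e| == 2}.
Definition odiagram (n : nat) := seq (oedge n).

Definition Delta R n := freemod R (diagram n).
Definition oDelta R n := freemod R (odiagram n).

Section Relations.
Variables (R : comPzRingType) (n : nat).

Local Notation "<[ D ]>" := (fm_gen R D).

Definition same_ends (e e' : edge n) : bool :=
  (val e' == val e) || (val e' == ((val e).2, (val e).1)).

Inductive I_rel : Delta R n -> Prop :=
| I_Arnold (D : diagram n) (i j k : 'I_n) (ij jk ki : edge n) :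
    val ij = (i, j) -> val jk = (j, k) -> val ki = (k, i) ->
    I_rel (<[ ij +` (jk +` D) ]> + <[ jk +` (ki +` D) ]>
           + <[ ki +` (ij +` D) ]>)
| I_symmetry (D : diagram n) (e e' : edge n) :
    val e' = ((val e).2, (val e).1) ->
    I_rel (<[ e +` D ]> + <[ e' +` D ]>)
| I_multiple (D : diagram n) (e e' : edge n) :
    same_ends e e' -> I_rel <[ e +` (e' +` D) ]>.

Inductive oI_rel : oDelta R n -> Prop :=
| oI_Arnold (A B : odiagram n) (i j k : 'I_n) (ij jk ki : oedge n) :
    val ij = [set i; j] -> val jk = [set j; k] -> val ki = [set k; i] ->
    oI_rel (<[ A ++ ij :: jk :: B ]> + <[ A ++ jk :: ki :: B ]>
            + <[ A ++ ki :: ij :: B ]>)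
| oI_symmetry (m : nat) (D D' : m.-tuple (oedge n)) (p : 'S_m) :
    (forall a, tnth D' a = tnth D (p a)) ->
    oI_rel (<[ D : odiagram n ]> - (-1) ^+ p *: <[ D' : odiagram n ]>)
| oI_multiple (D : odiagram n) : ~~ uniq D -> oI_rel <[ D ]>.

Definition Siop : lmodType R := quotm I_rel.
Definition oSiop : lmodType R := quotm oI_rel.

Definition Siop_pi : {linear Delta R n -> Siop} := quotm_pi I_rel.
Definition oSiop_pi : {linear oDelta R n -> oSiop} := quotm_pi oI_rel.

End Relations.

(* [Node t ts] is an internal vertex with nonempty list of branches [t :: ts];
   the root edge is implicit, and [Leaf] is the tree reduced to it. *)
Inductive rptree := Leaf | Node of rptree & seq rptree.

(* A vertex is addressed by the branch labels met on the way up from the root,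
   so its distance to the root is the size of its address. *)
Definition address := seq nat.

Fixpoint subtree (t : rptree) (v : address) {struct v} : option rptree :=
  match v, t with
  | [::], _ => Some t
  | b :: v', Node t0 ts =>
      if onth (t0 :: ts) b is Some s then subtree s v' else None
  | _ :: _, Leaf => None
  end.

Definition arity (t : rptree) (v : address) : nat :=
  if subtree t v is Some (Node _ ts) then (size ts).+1 else 0.

Fixpoint vertices (t : rptree) : seq address :=
  [::] :: match t with
          | Leaf => [::]
          | Node t0 ts =>
              let L := vertices t0 :: map vertices ts in
              flatten [seq [seq b :: v | v <- nth [::] L b] | b <- iota 0 (size L)]
          end.

(* [vertices] is in preorder, hence [leaves] is in left-to-right order. *)
Definition leaves (t : rptree) : seq address :=
  [seq v <- vertices t | arity t v == 0].
Definition internal (t : rptree) : seq address :=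
  [seq v <- vertices t | arity t v != 0].

Definition nleaves (t : rptree) : nat := size (leaves t).

Section CooperadMap.
Variable t : rptree.
Local Notation n := (nleaves t).

Definition leaf (j : 'I_n) : address := tnth (in_tuple (leaves t)) j.

Definition tree_adj : rel address := [rel u v |
  (prefix u v && (size v == (size u).+1)) ||
  (prefix v u && (size u == (size v).+1))].

Definition tree_path (u : address) (p : seq address) (v : address) : Prop :=
  [/\ {subset u :: p <= vertices t}, path tree_adj u p & last u p = v].

Definition shortest_path u p v : Prop :=
  tree_path u p v /\ forall q, tree_path u q v -> (size p <= size q)%N.

Definition is_nadir (j k : 'I_n) (v : address) : Prop :=
  exists p, [/\ shortest_path (leaf j) p (leaf k), v \in leaf j :: p
    & forall u, u \in leaf j :: p -> (size v <= size u)%N].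

(* [is_J v j b] says that [b = J_v(j)]; branches are counted from 0. *)
Definition is_J (v : address) (j : 'I_n) (b : 'I_(arity t v)) : bool :=
  prefix (rcons v b) (leaf j).

(* The edge of D_v coming from the edge [e] of D; [None] if the nadir of [e] is
   not [v]. *)
Definition edge_at (v : address) (e : edge n) : option (edge (arity t v)) :=
  [pick e' : edge (arity t v) |
    [&& `[< is_nadir (val e).1 (val e).2 v >],
        is_J (val e).1 (val e').1 & is_J (val e).2 (val e').2]].

Definition oedge_at (v : address) (e : oedge n) : option (oedge (arity t v)) :=
  [pick e' : oedge (arity t v) |
    [exists j, exists k, exists a, exists b,
      [&& val e == [set j; k], `[< is_nadir j k v >],
          val e' == [set a; b], is_J j a & is_J k b]]].

Definition diag_at (v : address) (D : diagram n) : diagram (arity t v) :=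
  seq_mset (pmap (edge_at v) (enum_mset D)).

Definition odiag_at (v : address) (D : odiagram n) : odiagram (arity t v) :=
  pmap (oedge_at v) D.

Section Ordering.
Variable vs : seq address.
Local Notation vtx := (tnth (in_tuple vs)).

(* The positions in D of the edges of the D_v, for v in vs, concatenated. *)
Definition concat_edges (D : odiagram n) : seq 'I_(size D) :=
  flatten [seq [seq a <- enum 'I_(size D) |
                  isSome (oedge_at v (tnth (in_tuple D) a))] | v <- vs].

Definition concat_perm (D : odiagram n) : 'S_(size D) :=
  odflt 1%g [pick p : 'S_(size D) |
    [seq p a | a <- enum 'I_(size D)] == concat_edges D].

Variable R : comPzRingType.

Definition Delta_tensor := tensor (fun i => Delta R (arity t (vtx i))).
Definition oDelta_tensor := tensor (fun i => oDelta R (arity t (vtx i))).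
Definition Siop_tensor := tensor (fun i => Siop R (arity t (vtx i))).
Definition oSiop_tensor := tensor (fun i => oSiop R (arity t (vtx i))).

Definition g_map : {linear Delta R n -> Delta_tensor} :=
  fm_lift (fun D => tens (fun i => fm_gen R (diag_at (vtx i) D))).

Definition og_map : {linear oDelta R n -> oDelta_tensor} :=
  fm_lift (fun D => (-1) ^+ (concat_perm D) *:
                    tens (fun i => fm_gen R (odiag_at (vtx i) D))).

Definition Siop_tensor_pi : {linear Delta_tensor -> Siop_tensor} :=
  tensor_map (fun i => Siop_pi R (arity t (vtx i))).

Definition oSiop_tensor_pi : {linear oDelta_tensor -> oSiop_tensor} :=
  tensor_map (fun i => oSiop_pi R (arity t (vtx i))).

End Ordering.
End CooperadMap.

(* Main.v *)
From HB Require Import structures.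
Require Import Defs.
From mathcomp Require Import all_boot all_order all_fingroup all_algebra.
From mathcomp Require Import finmap multiset boolp zify.

Set Implicit Arguments.
Unset Strict Implicit.
Unset Printing Implicit Defensive.

Import GRing.Theory.

(* The nadir of two leaves is the vertex at which their addresses branch off, so
   each edge of D lands in exactly one factor D_v.  A symmetry or multiple-edge
   relation of D therefore becomes the same relation in one factor.  Three leaves
   i, j, k either split three ways at one vertex, where the Arnold relation
   becomes an Arnold relation, or two of them, say i and j, stay together at the
   vertex v where k splits off.  In the second case jk and ki become parallel
   edges of D_v, which kills one term; the other two terms differ by reversing an
   edge of D_v, or, for ordered edges, by exchanging two consecutive edges lying
   over different vertices, and they cancel.

   The sign in the ordered case is that of the stable sort of the edges of D by
   nadir, that is, the parity of the inversions of the word of nadirs of D.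
   Exchanging consecutive edges of D then either swaps two consecutive edges of a
   factor or changes that parity, so the image is alternating. *)

(** * The combinatorics of nadirs *)

Lemma vertices_Node t0 ts : vertices (Node t0 ts) =
  [::] :: [seq b :: v | b <- iota 0 (size ts).+1,
                        v <- vertices (nth Leaf (t0 :: ts) b)].
Proof.
congr (_ :: flatten _); rewrite -[LHS]/(map _ (iota 0 (size (map _ _)).+1)) size_map.
apply/eq_in_map => b; rewrite mem_iota add0n => /andP [_ b_lt].
by rewrite -[_ :: map _ _]/(map vertices (t0 :: ts)) (nth_map Leaf).
Qed.

Lemma mem_vertices t v : (v \in vertices t) = isSome (subtree t v).
Proof.
elim: v t => [|b v IHv] [|t0 ts] //; rewrite vertices_Node in_cons [_ == _]/= orFb.
rewrite -[X in isSome X]/(if onth (t0 :: ts) b is Some s then subtree s v else None).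
apply/allpairsPdep/idP => [[b' [w [b_lt w_in [? ?]]]]|].
  subst b' w; move: b_lt w_in; rewrite mem_iota => b_lt.
  rewrite IHv; case E: onth => [s|].
    by rewrite (onth_nth Leaf _ _ _ E).
  by have := onthTE (t0 :: ts) b; rewrite E [RHS]b_lt.
case E: onth => [s|] // v_in; exists b, v.
by rewrite mem_iota -[_ < _](onthTE (t0 :: ts)) E IHv (onth_nth Leaf _ _ _ E).
Qed.

Lemma subtree_cat t u v :
  subtree t (u ++ v) = if subtree t u is Some s then subtree s v else None.
Proof. by elim: u t => [|b u IHu] [|t0 ts] //=; case: onth. Qed.

Lemma prefix_vertices t u v :
  prefix u v -> v \in vertices t -> u \in vertices t.
Proof.
by case/prefixP=> w ->; rewrite !mem_vertices subtree_cat; case: (subtree t u).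
Qed.

(** The generated induction principle gives no hypothesis on the trees inside [ts]. Quantifying over
    [nth Leaf] covers all branches at once; indices out of range fall under [P Leaf]. *)
Lemma rptree_nth_ind (P : rptree -> Prop) : P Leaf ->
  (forall t0 ts, (forall b, P (nth Leaf (t0 :: ts) b)) -> P (Node t0 ts)) ->
  forall t, P t.
Proof.
move=> PLeaf PNode; fix IH 1 => t; case: t => [|t0 ts]; first exact: PLeaf.
apply: PNode => -[|b]; first exact: IH.
move: b; elim: ts => [|s ts IHts] [|b]; [exact PLeaf | exact PLeaf | |].
  exact: IH.
exact: IHts.
Qed.

Lemma uniq_vertices t : uniq (vertices t).
Proof.
elim/rptree_nth_ind: t => // t0 ts IHt.
rewrite vertices_Node cons_uniq; apply/andP; split.
  by apply/negP => /allpairsPdep [b [v []]].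
apply: allpairs_uniq_dep => [|b|[b v] [b' v'] _ _ /= [-> ->] //].
  exact: iota_uniq.
by move=> _; apply: IHt.
Qed.

Lemma prefix_branch (v w : address) :
  prefix v w -> v != w -> exists b, prefix (rcons v b) w.
Proof.
case/prefixP=> -[|b s] ->; first by rewrite cats0 eqxx.
by exists b; rewrite -cat_rcons prefix_prefix.
Qed.

Lemma prefix_total (u v w : address) : prefix u w -> prefix v w ->
  prefix u v \/ prefix v u.
Proof.
move=> /prefixP [s ->]; elim: u v => [|x u IHu] [|y v] /=; rewrite ?prefix0s;
  try by [left|right].
by case/andP=> /eqP -> /IHu; rewrite eqxx.
Qed.

Lemma rcons_prefix_inj (v w : address) a b :
  prefix (rcons v a) w -> prefix (rcons v b) w -> a = b.
Proof.
move=> /prefixP [s ->] /prefixP [s'].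
by rewrite !cat_rcons => /eqP; rewrite eqseq_cat // eqxx /= => /eqP [->].
Qed.

(** The address [v] is the longest common prefix of [u] and [w]: if [m] went past [v], its next
    letter would be both [a] and [b]. *)
Lemma prefix_meet (v u w m : address) a b :
  prefix (rcons v a) u -> prefix (rcons v b) w -> a != b ->
  prefix m u -> prefix m w -> prefix m v.
Proof.
move=> va vb ab m_u m_w; have v_u := prefix_trans (prefix_rcons _ _) va.
have [//|v_m] := prefix_total m_u v_u.
have [->|vm] := eqVneq v m; first exact: prefix_refl.
have [c vc] := prefix_branch v_m vm.
have ca := rcons_prefix_inj (prefix_trans vc m_u) va.
have cb := rcons_prefix_inj (prefix_trans vc m_w) vb.
by rewrite -ca -cb eqxx in ab.
Qed.

Lemma prefix_anti (u v : address) : prefix u v -> prefix v u -> u = v.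
Proof.
move=> uv vu; apply/eqP; move: uv; rewrite prefixE.
by rewrite take_oversize ?(size_prefix vu) // eq_sym.
Qed.

Lemma meet_exists (u w : address) : ~~ prefix u w -> ~~ prefix w u ->
  exists v a b, [/\ prefix (rcons v a) u, prefix (rcons v b) w & a != b].
Proof.
elim: u w => [|x u IHu] [|y w] //=; rewrite [y == x]eq_sym.
have [<-|xy] := eqVneq x y.
  rewrite /= => /IHu {}IHu /IHu [v [a [b [va vb ab]]]].
  by exists (x :: v), a, b; rewrite /= eqxx.
by move=> _ _; exists [::], x, y; rewrite /= !eqxx !prefix0s.
Qed.

(** * Leaves and the vertices where they branch off *)

Section Leaves.
Variable t : rptree.
Implicit Types (j k l : 'I_(nleaves t)) (v : address).

Lemma leaf_inj : injective (@leaf t).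
Proof.
move=> j k /eqP; rewrite /leaf !(tnth_nth [::]) nth_uniq //.
  by move=> /eqP /val_inj.
exact/filter_uniq/uniq_vertices.
Qed.

(** Addresses outside the tree also have arity 0; membership in [vertices] excludes them, and a
    [Node] has at least one branch. *)
Lemma subtree_leaf j : subtree t (leaf j) = Some Leaf.
Proof.
have: leaf j \in leaves t by apply: mem_tnth.
by rewrite mem_filter /arity mem_vertices; case: subtree => [[|? ?]|]; rewrite ?andbF.
Qed.

Lemma leaf_vertices j : leaf j \in vertices t.
Proof. by rewrite mem_vertices subtree_leaf. Qed.

Lemma branch_arity v b j : prefix (rcons v b) (leaf j) -> b < arity t v.
Proof.
move=> /prefix_vertices /(_ (leaf_vertices j)).
rewrite mem_vertices -cats1 subtree_cat /arity.
case: subtree => [[|t0 ts]|] //=; case E: onth => [s|] // _.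
by have := onthTE (t0 :: ts) b; rewrite E.
Qed.

Lemma leaf_branch v j : v \in vertices t -> prefix v (leaf j) ->
  arity t v != 0 -> exists b : 'I_(arity t v), is_J j b.
Proof.
move=> v_in v_le ar; have [|b b_le] := prefix_branch v_le.
  by apply: contraNneq ar => ->; rewrite /arity subtree_leaf.
by exists (Ordinal (branch_arity b_le)).
Qed.

Lemma is_J_inj v j (a b : 'I_(arity t v)) : is_J j a -> is_J j b -> a = b.
Proof. by move=> ja jb; apply/val_inj/(rcons_prefix_inj ja jb). Qed.

Lemma is_J_prefix v j (a : 'I_(arity t v)) : is_J j a -> prefix v (leaf j).
Proof. exact: prefix_trans (prefix_rcons _ _). Qed.

(** Both vertices are the longest common prefix of the two leaf addresses. *)
Lemma split_unique v v' j k (a b : 'I_(arity t v)) (a' b' : 'I_(arity t v')) :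
  is_J j a -> is_J k b -> a != b -> is_J j a' -> is_J k b' -> a' != b' ->
  v = v'.
Proof.
move=> ja kb ab ja' kb' ab'; apply: prefix_anti.
  exact: prefix_meet ja' kb' ab' (is_J_prefix ja) (is_J_prefix kb).
exact: prefix_meet ja kb ab (is_J_prefix ja') (is_J_prefix kb').
Qed.

Lemma leaf_prefix j k : prefix (leaf j) (leaf k) -> j = k.
Proof.
move=> jk; apply: leaf_inj; apply/eqP; apply/negP => /negP /(prefix_branch jk) [b].
by move/branch_arity; rewrite /arity subtree_leaf.
Qed.

Lemma split_exists j k : j != k ->
  exists2 v, v \in internal t &
    exists a b : 'I_(arity t v), [/\ is_J j a, is_J k b & a != b].
Proof.
move=> jk; have [||v [a [b [ja kb ab]]]] := @meet_exists (leaf j) (leaf k).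
- by apply: contraNN jk => /leaf_prefix ->.
- by apply: contraNN jk => /leaf_prefix ->.
have a_lt := branch_arity ja; have b_lt := branch_arity kb.
exists v; last by exists (Ordinal a_lt), (Ordinal b_lt).
rewrite mem_filter -lt0n (leq_ltn_trans _ a_lt) //=.
exact: prefix_vertices (prefix_trans (prefix_rcons _ _) ja) (leaf_vertices j).
Qed.

Definition grouped i j k v :=
  exists a b : 'I_(arity t v), [/\ is_J i a, is_J j a, is_J k b & a != b].

Definition three_way i j k v :=
  exists a b c : 'I_(arity t v),
    [/\ is_J i a, is_J j b, is_J k c & uniq [:: a; b; c]].

Lemma split_three i j k : i != j -> j != k -> k != i ->
  exists2 v, v \in internal t &
    [\/ three_way i j k v, grouped i j k v, grouped j k i v | grouped k i j v].
Proof.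
move=> ij jk ki; have [v v_in [a [b [ia jb ab]]]] := split_exists ij.
have [/[dup] v_k|v_k] := boolP (prefix v (leaf k)).
  move/leaf_branch => [||c kc]; try by move: v_in; rewrite mem_filter => /andP [].
  exists v => //; have [ca|ca] := eqVneq c a.
    by subst c; constructor 4; exists a, b.
  have [cb|cb] := eqVneq c b.
    by subst c; constructor 3; exists b, a; rewrite eq_sym.
  by constructor 1; exists a, b, c; split; rewrite //= !inE negb_or ab eq_sym ca eq_sym cb.
(* Now [k] leaves the path to [j] at a vertex [w] strictly closer to the root than [v]; since [i]
   agrees with [j] up to [v], it stays with [j] past [w]. *)
have [w w_in [b' [c [jb' kc bc]]]] := split_exists jk.
exists w => //; constructor 2; exists b', c; split=> //.
have [v_w|w_v] := prefix_total (is_J_prefix jb) (is_J_prefix jb').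
  by rewrite (prefix_trans v_w (is_J_prefix kc)) in v_k.
have [|x wx] := prefix_branch w_v.
  by apply: contraNneq v_k => <-; apply: is_J_prefix kc.
have xb := rcons_prefix_inj (prefix_trans wx (is_J_prefix jb)) jb'.
by rewrite /is_J -xb (prefix_trans wx (is_J_prefix ia)).
Qed.

End Leaves.

(** * Walks and shortest paths in the tree *)

(** A step adds or removes one last letter, so a walk is at least as long as the route from [u] to
    [w] through some common prefix [m]. *)
Lemma walk_size (u w : address) p : path tree_adj u p -> last u p = w ->
  exists m : address,
    [/\ prefix m u, prefix m w & size u + size w <= size p + (size m).*2].
Proof.
elim: p u => [|u' p IHp] u /=; first by move=> _ <-; exists u; rewrite addnn prefix_refl.
case/andP=> + /IHp{}IHp /IHp [m [m_u' m_w le_m]].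
case/orP=> /andP [pre /eqP].
  rewrite -[_ = _ :> _]/(size u' = (size u).+1) => sz.
  have [m_u|u_m] := prefix_total m_u' pre.
    by exists m; split=> //; lia.
  (* Here [m] may contain the letter just added. Replacing it by [u] costs at most two in the bound,
     made up by the shorter start and the extra step. *)
  exists u; rewrite prefix_refl (prefix_trans u_m m_w); split=> //.
  have : size m <= size u' by apply: size_prefix.
  by lia.
rewrite -[_ = _ :> _]/(size u = (size u').+1) => sz.
exists m; rewrite (prefix_trans m_u' pre); split=> //; lia.
Qed.

(** The half of a shortest path that runs towards the root. Its vertices are prefixes of [q ++ s],
    which keeps them in the tree, and no shorter than [q], which makes [q] the nadir. *)
Lemma ascent (q s : address) : exists p, [/\ path tree_adj (q ++ s) p,
  last (q ++ s) p = q, size p = size s &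
  {in p, forall z, prefix z (q ++ s) && (size q <= size z)}].
Proof.
elim/last_ind: s => [|s x [p [pth lst sz pin]]]; first by exists [::]; rewrite cats0.
have pre : prefix (q ++ s) (q ++ rcons s x) by rewrite -rcons_cat prefix_rcons.
exists ((q ++ s) :: p); split=> //=.
- by rewrite pth /tree_adj /= pre -rcons_cat size_rcons eqxx orbT.
- by rewrite size_rcons; congr _.+1.
- move=> z; rewrite in_cons => /predU1P [->|/pin /andP [z_s ->]].
    by rewrite pre size_cat leq_addr.
  by rewrite (prefix_trans z_s pre).
Qed.

Lemma descent (q s : address) : exists p, [/\ path tree_adj q p,
  last q p = q ++ s, size p = size s &
  {in p, forall z, prefix z (q ++ s) && (size q <= size z)}].
Proof.
elim/last_ind: s => [|s x [p [pth lst sz pin]]]; first by exists [::]; rewrite cats0.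
have pre : prefix (q ++ s) (q ++ rcons s x) by rewrite -rcons_cat prefix_rcons.
exists (rcons p (q ++ rcons s x)); split=> //=.
- by rewrite rcons_path pth lst /tree_adj /= pre -rcons_cat size_rcons eqxx.
- by rewrite last_rcons.
- by rewrite !size_rcons; congr _.+1.
- move=> z; rewrite mem_rcons in_cons => /predU1P [->|/pin /andP [z_s ->]].
    by rewrite prefix_refl size_cat leq_addr.
  by rewrite (prefix_trans z_s pre).
Qed.

(** The two halves are joined at [v]. For any competing path [walk_size] gives the same length
    estimate with a common prefix [m] in place of [v], and [m] is no longer than [v] by
    [prefix_meet]. *)
Lemma split_nadir t v (j k : 'I_(nleaves t)) (a b : 'I_(arity t v)) :
  is_J j a -> is_J k b -> a != b -> is_nadir j k v.
Proof.
rewrite /is_J => ja kb ab.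
have vj := prefix_trans (prefix_rcons _ _) ja.
have vk := prefix_trans (prefix_rcons _ _) kb.
have [s js] := prefixP vj; have [s' ks] := prefixP vk.
have [p [pth lst sz pin]] := ascent v s.
have [p' [pth' lst' sz' pin']] := descent v s'.
rewrite -js -ks in pth lst pin lst' pin'.
have in_t z : z \in leaf j :: (p ++ p') -> z \in vertices t.
  rewrite in_cons mem_cat => /or3P [/eqP ->|/pin /andP [z_le _]|/pin' /andP [z_le _]].
  - exact: leaf_vertices.
  - exact: prefix_vertices z_le (leaf_vertices _).
  - exact: prefix_vertices z_le (leaf_vertices _).
exists (p ++ p'); split.
- split; first by split; rewrite ?cat_path ?last_cat ?lst ?pth.
  move=> q [_ /walk_size qpth /qpth [m [m_j m_k le_m]]].
  have: size m <= size v.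
    exact: size_prefix (prefix_meet ja kb ab m_j m_k).
  move: le_m; rewrite js ks size_cat sz sz' !size_cat; lia.
- by have := mem_last (leaf j) p; rewrite lst -cat_cons mem_cat => ->.
move=> u; rewrite in_cons mem_cat => /or3P [/eqP ->|/pin /andP [_ //]|/pin' /andP [_ //]].
by rewrite js size_cat leq_addr.
Qed.

(** * Signs *)

Fixpoint inversions (s : seq nat) : nat :=
  if s is x :: s' then count (fun y => y < x) s' + inversions s' else 0.

Lemma odd_inversions_swap A (x y : nat) B : x != y ->
  odd (inversions (A ++ x :: y :: B)) = ~~ odd (inversions (A ++ y :: x :: B)).
Proof.
(* Only the comparison of [x] with [y] changes; the additive form avoids truncated subtraction. *)
have E : inversions (A ++ x :: y :: B) + (x < y) =
         inversions (A ++ y :: x :: B) + (y < x).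
  elim: A => [|z A IHA] /=; first lia.
  by rewrite !count_cat /=; lia.
by move/(congr1 odd): E; rewrite !oddD; case: ltngtP => //=;
  rewrite ?addbT ?addbF => _ <-; rewrite ?negbK.
Qed.

(** The counterpart of [lift] for lists: [bump (size A)] skips the position of [y]. *)
Lemma nth_bump T (x0 : T) A y B a :
  nth x0 (A ++ y :: B) (bump (size A) a) = nth x0 (A ++ B) a.
Proof.
rewrite !nth_cat /bump; case: (leqP (size A) a) => [le_a|lt_a]; last by rewrite add0n lt_a.
by rewrite add1n ltnNge leqW //= subSn.
Qed.

Definition color_block (s : seq nat) i := [seq a <- iota 0 (size s) | nth 0 s a == i].

Lemma color_block_cons x s i : color_block (x :: s) i =
  (if x == i then [:: 0] else [::]) ++ map S (color_block s i).
Proof.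
rewrite /color_block /= -[1]/(1 + 0) iotaDl filter_map.
by case: ifP => _ //=.
Qed.

Lemma size_color_block s i : size (color_block s i) = count (pred1 i) s.
Proof.
elim: s => //= x s IHs; rewrite color_block_cons size_cat size_map IHs.
by case: eqP.
Qed.

(* The one-line notation of the permutation that sorts [s] stably. *)
Definition color_sort m s := flatten [seq color_block s i | i <- iota 0 m].

Lemma size_color_sort m s : size (color_sort m s) = count (fun y => y < m) s.
Proof.
elim: m => [|m IHm]; first by rewrite count_pred0.
rewrite /color_sort -addn1 iotaD map_cat flatten_cat size_cat [size _]IHm /=.
rewrite cats0 size_color_block add0n -count_predUI addnC.
rewrite (eq_count (a1 := predI _ _) (a2 := pred0)) ?count_pred0.
  by apply: eq_count => y /=; lia.
by move=> y /=; lia.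
Qed.

(** By induction on the word. The new position 0 comes right after the positions of all letters
    smaller than [x], so the permutation is a lift of the previous one, and the parity changes by
    the number of those letters, the inversions involving [x]. *)
Lemma color_sort_perm m n s : size s = n -> all (fun y => y < m) s ->
  exists p : 'S_n, (forall a : 'I_n, nth 0 (color_sort m s) a = p a) /\
                   odd_perm p = odd (inversions s).
Proof.
elim: s n => [|x s IHs] [|n] //= => [_ _|[sz] /andP [x_m s_m]].
  by exists 1%g; rewrite odd_perm1; split=> // -[].
have [p [sp op]] := IHs n sz s_m.
(* The blocks of colours below [x] and from [x] on; the new 0 goes between them, at the head of
   block [x]. *)
set G1 := color_sort x s; set G2 := flatten [seq color_block s i | i <- iota x (m - x)].
have m_def : m = x + (m - x.+1).+1 by lia.
have G12 : color_sort m s = G1 ++ G2.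
  by rewrite /G1 /G2 /color_sort -flatten_cat -map_cat -iotaD;
    congr (flatten (map _ (iota _ _))); lia.
have xG : color_sort m (x :: s) = map S G1 ++ 0 :: map S G2.
  have off r : x \notin r -> flatten [seq color_block (x :: s) i | i <- r] =
      map S (flatten [seq color_block s i | i <- r]).
    move=> x_r; rewrite map_flatten -map_comp; congr flatten; apply/eq_in_map=> i i_r.
    by rewrite color_block_cons; case: eqP => // xi; rewrite xi i_r in x_r.
  rewrite /color_sort m_def iotaD map_cat flatten_cat off; last by rewrite mem_iota; lia.
  congr (_ ++ _); rewrite /G2 (_ : m - x = (m - x.+1).+1); last by lia.
  rewrite /= off; last by rewrite mem_iota; lia.
  by rewrite color_block_cons eqxx /= map_cat.
have szG1 : size (map S G1) = count (fun y => y < x) s by rewrite size_map size_color_sort.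
have k_n : count (fun y => y < x) s < n.+1 by rewrite ltnS -sz count_size.
exists (lift_perm (Ordinal k_n) ord0 p); split; last first.
  by rewrite odd_lift_perm /= addbF op oddD.
move=> a; rewrite xG; case: (unliftP (Ordinal k_n) a) => [b ->|->].
  rewrite lift_perm_lift /= -szG1 nth_bump -map_cat -G12 -sp (nth_map 0) //.
  by rewrite size_color_sort (eqP (etrans (esym (all_count _ _)) s_m)) sz.
by rewrite lift_perm_id /= -szG1 nth_cat ltnn subnn.
Qed.

(** * Alternating functions of sequences *)

Section Alternating.
Variables (R : pzRingType) (V : lmodType R) (T : eqType) (F : seq T -> V).
Local Open Scope ring_scope.
Hypothesis F_swap : forall A x y B, F (A ++ x :: y :: B) = - F (A ++ y :: x :: B).

Lemma alternating_move A x B W :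
  F (W ++ A ++ x :: B) = (-1) ^+ size A *: F (W ++ x :: A ++ B).
Proof.
elim: A W => [|y A IHA] W /=; first by rewrite expr0 scale1r.
by rewrite -cat_rcons IHA cat_rcons F_swap exprSr scalerN mulrN1 scaleNr.
Qed.

(** Deleting 0 and its image leaves a permutation of [n] points, on which one can induct. *)
Lemma perm_lift0 n (p : 'S_n.+1) : exists s, p = lift_perm ord0 (p ord0) s.
Proof.
have ne k : p ord0 != p (lift ord0 k) by rewrite (inj_eq perm_inj).
pose f k := sval (unlift_some (ne k)).
have fK k : lift (p ord0) (f k) = p (lift ord0 k) by rewrite /f; case: unlift_some.
have f_inj : injective f.
  by move=> k k' /(congr1 (lift (p ord0))); rewrite !fK => /perm_inj /lift_inj.
exists (perm f_inj); apply/permP => a; case: (unliftP ord0 a) => [k ->|->].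
  by rewrite lift_perm_lift permE fK.
by rewrite lift_perm_id.
Qed.

(** The first entry of [D'] sits at position [p ord0] of [D]. Bringing it to the front takes that
    many swaps, it then joins the prefix [W] of entries already in place, and induction handles the
    rest. *)
Lemma alternating_perm x0 n (p : 'S_n) W D D' : size D = n -> size D' = n ->
  (forall a : 'I_n, nth x0 D' a = nth x0 D (p a)) ->
  F (W ++ D) = (-1) ^+ p *: F (W ++ D').
Proof.
elim: n => [|n IHn] in p W D D' *.
  move=> /size0nil -> /size0nil -> _; rewrite (_ : p = 1%g); last by apply/permP=> -[].
  by rewrite odd_perm1 scale1r.
case: D' => // x D' szD [szD'] D'p; have [s ps] := perm_lift0 p.
have p0 : (p ord0 < size D)%N by rewrite szD.
set A := take (p ord0) D; set B := drop (p ord0).+1 D.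
have szA : size A = p ord0 by rewrite size_takel // ltnW.
have D_def : D = A ++ x :: B.
  by rewrite -[LHS](cat_take_drop (p ord0)) (drop_nth x0) // -(D'p ord0).
rewrite D_def alternating_move -cat_rcons (IHn s _ _ D') //; first last.
- move=> a; rewrite -(nth_bump x0 A x B) -D_def.
  by have := D'p (lift ord0 a); rewrite lift0 /= => ->; rewrite {1}ps lift_perm_lift szA.
- by apply: succn_inj; rewrite -szD D_def !size_cat /= addnS.
have -> : (-1) ^+ p = (-1) ^+ p ord0 * (-1) ^+ s :> R.
  by rewrite {1}ps odd_lift_perm /= signr_addb signr_odd.
by rewrite cat_rcons scalerA szA.
Qed.
End Alternating.

(** * Tensors *)

Local Open Scope ring_scope.
Local Open Scope mset_scope.

Section QuotientFactor.
Variables (R : comPzRingType) (V W : lmodType R) (S : V -> Prop).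
Variable f : {linear V -> W}.
Hypothesis f0 : forall v, S v -> f v = 0.

(** The universal property of the quotient, computed on chosen representatives; the value is
    independent of the choice because [f] kills [S]. *)
Definition quotm_factor (q : Defs.quotm S) : W := f (generic_quotient.repr q).

Lemma quotm_factor_pi v : quotm_factor (quotm_pi S v) = f v.
Proof. exact: (linear_repr f0). Qed.

Fact quotm_factor_linear : linear quotm_factor.
Proof.
move=> a p q; rewrite -[p in LHS]quotm_repr -[q in LHS]quotm_repr -linearP.
by rewrite quotm_factor_pi linearP.
Qed.

HB.instance Definition _ :=
  GRing.isLinear.Build R (Defs.quotm S) W *:%R quotm_factor quotm_factor_linear.

Lemma quotm_factor_exists :
  exists h : {linear Defs.quotm S -> W}, forall v, h (quotm_pi S v) = f v.
Proof. by exists quotm_factor => v; apply: quotm_factor_pi. Qed.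
End QuotientFactor.

Section TensorSlot.
Variables (R : comPzRingType) (I : finType) (M : I -> lmodType R).
Implicit Types x y z : forall i, M i.

(** A pure tensor as a linear function of its factor [i], so that the generic lemmas on linear maps
    apply; the entry of [x] at [i] is overwritten. *)
Definition tens_slot x i (u : M i) : tensor M := tens (dfwith x u).

Fact tens_slot_linear x i : linear (@tens_slot x i).
Proof. by move=> a u v; apply: tens_linear. Qed.

HB.instance Definition _ x i :=
  GRing.isLinear.Build R (M i) (tensor M) *:%R (@tens_slot x i)
    (@tens_slot_linear x i).

Lemma tens_slotE x y i : (forall j, j != i -> y j = x j) ->
  tens y = tens_slot x (y i).
Proof.
move=> yx; congr tens; apply: functional_extensionality_dep => j.
by case: (eqVneq i j) => [<-|ij]; rewrite ?dfwith_in // dfwith_out // yx // eq_sym.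
Qed.

Lemma tens_eq0 x i : x i = 0 -> tens x = 0.
Proof. by move=> xi0; rewrite (@tens_slotE x x i) // xi0 linear0. Qed.

Lemma tens_addN x y i : (forall j, j != i -> y j = x j) -> x i + y i = 0 ->
  tens x + tens y = 0.
Proof.
by move=> yx xy0; rewrite (@tens_slotE x x i) // (tens_slotE yx) -linearD xy0 linear0.
Qed.

Lemma tens_add3 x y z i : (forall j, j != i -> y j = x j) ->
  (forall j, j != i -> z j = x j) -> x i + y i + z i = 0 ->
  tens x + tens y + tens z = 0.
Proof.
move=> yx zx xyz0; rewrite (@tens_slotE x x i) // (tens_slotE yx) (tens_slotE zx).
by rewrite -!linearD xyz0 linear0.
Qed.
End TensorSlot.

(** * Oriented edges *)

Section Edges.
Variable t : rptree.
Local Notation n := (nleaves t).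

(** The nadir condition in [edge_at] follows from the other two: the ends of [f] are distinct
    branches, so the leaves split at [v]. *)
Lemma edge_atP v (e : edge n) (f : edge (arity t v)) :
  edge_at v e = Some f <->
  is_J (val e).1 (val f).1 && is_J (val e).2 (val f).2.
Proof.
rewrite /edge_at; split; first by case: pickP => // f' /and3P [_ J1 J2] [<-]; rewrite J1.
move=> /andP [J1 J2]; case: pickP => [f' /and3P [_ J1' J2']|/(_ f)].
  congr Some; apply: val_inj; rewrite [val f']surjective_pairing [RHS]surjective_pairing.
  by rewrite (is_J_inj J1 J1') (is_J_inj J2 J2').
by rewrite J1 J2 (asboolT (split_nadir J1 J2 (valP f))).
Qed.

Lemma edge_at_unique v v' (e : edge n) :
  edge_at v e -> edge_at v' e -> v = v'.
Proof.
case E: edge_at => [f|] // _; case E': edge_at => [f'|] // _.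
move: E E' => /edge_atP /andP [J1 J2] /edge_atP /andP [J1' J2'].
exact: split_unique J1 J2 (valP f) J1' J2' (valP f').
Qed.

Lemma edge_at_J v (e : edge n) (j k : 'I_n) (a b : 'I_(arity t v)) :
  val e = (j, k) -> is_J j a -> is_J k b -> a != b ->
  exists2 f, edge_at v e = Some f & val f = (a, b).
Proof.
move=> ejk ja kb ab; exists (exist _ (a, b) ab) => //.
by apply/edge_atP; rewrite ejk ja.
Qed.

Lemma edge_at_exists (e : edge n) : exists2 v, v \in internal t & edge_at v e.
Proof.
have [v v_in [a [b [J1 J2 ab]]]] := split_exists (valP e); exists v => //.
by have [f ->] := edge_at_J (surjective_pairing (val e)) J1 J2 ab.
Qed.

Lemma edge_at_same v (e : edge n) (j k : 'I_n) (a : 'I_(arity t v)) :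
  val e = (j, k) -> is_J j a -> is_J k a -> edge_at v e = None.
Proof.
move=> ejk ja ka; case E: edge_at => [f|] //.
move: E => /edge_atP; rewrite ejk => /andP [/= /(is_J_inj ja) fa /(is_J_inj ka) fb].
by have := valP f; rewrite -fa -fb eqxx.
Qed.

(** The enumeration of a multiset has the new edge in front only up to permutation, which [seq_mset]
    forgets. *)
Lemma diag_atD v (e : edge n) (D : diagram n) : diag_at v (e +` D) =
  if edge_at v e is Some f then f +` diag_at v D else diag_at v D.
Proof.
have D_perm : perm_eq (enum_mset (e +` D)) (e :: enum_mset D).
  by have := perm_eq_seq_mset (e :: enum_mset D); rewrite mset_cons seq_mset_id.
rewrite /diag_at (eq_seq_msetP _ _ (perm_pmap _ D_perm)).
by rewrite /=; case: edge_at => [f|] //=; rewrite mset_cons.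
Qed.
End Edges.

(** * Relations in the quotients *)

Section SiopRelations.
Variables (R : comPzRingType) (n : nat).

Lemma Siop_pi0 x : I_rel x -> Siop_pi R n x = 0.
Proof.
move=> Ix; rewrite -[RHS](linear0 (Siop_pi R n)).
by apply/quotm_piP/span_gen; rewrite subr0.
Qed.

Lemma oSiop_pi0 x : oI_rel x -> oSiop_pi R n x = 0.
Proof.
move=> Ix; rewrite -[RHS](linear0 (oSiop_pi R n)).
by apply/quotm_piP/span_gen; rewrite subr0.
Qed.

Lemma oSiop_pi_swap A (x y : oedge n) B :
  oSiop_pi R n (fm_gen R (A ++ x :: y :: B)) =
  - oSiop_pi R n (fm_gen R (A ++ y :: x :: B)).
Proof.
pose m := size (A ++ x :: y :: B).
have szD : size (A ++ y :: x :: B) == m by rewrite /m !size_cat.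
have szA : ((size A).+1 < m)%N by rewrite /m size_cat /=; lia.
pose a0 := Ordinal (ltnW szA); pose a1 := Ordinal szA.
have a01 : a0 != a1 by rewrite -val_eqE /= neq_ltn ltnSn.
apply/eqP; rewrite -addr_eq0 -linearD; apply/eqP/oSiop_pi0.
(* A transposition has sign -1, so the sum takes the shape of a symmetry combination. *)
have -> : fm_gen R (A ++ y :: x :: B) =
    - ((-1) ^+ tperm a0 a1 *: fm_gen R (A ++ y :: x :: B)).
  by rewrite odd_tperm a01 scaleN1r opprK.
apply: (@oI_symmetry R n m (Tuple (eqxx m)) (Tuple szD)) => a.
rewrite !(tnth_nth x) /=.
case: tpermP => [->|->|] /=.
- by rewrite !nth_cat ltnn subnn ltnNge leqnSn /= subSnn.
- by rewrite !nth_cat ltnn subnn ltnNge leqnSn /= subSnn.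
move=> /eqP + /eqP; rewrite -!val_eqE /= !nth_cat.
case: ltngtP => // lt_a _ ne_a.
by case E: (a - size A)%N => [|[|c]] //; lia.
Qed.
End SiopRelations.

(** * The relations under the oriented map *)

Section Unordered.
Variables (R : comPzRingType) (t : rptree) (vs : seq address).
Hypothesis hvs : perm_eq vs (internal t).
Local Notation n := (nleaves t).
Local Notation vtx := (tnth (in_tuple vs)).

Lemma vtx_inj : injective vtx.
Proof.
move=> i j /eqP; rewrite !(tnth_nth [::]) nth_uniq // => [/eqP/val_inj//|].
by rewrite (perm_uniq hvs); apply/filter_uniq/uniq_vertices.
Qed.

Lemma vtx_exists v : v \in internal t -> exists i, v = vtx i.
Proof. by rewrite -(perm_mem hvs) => /(tnthP (in_tuple vs)). Qed.

Lemma edge_at_None (i i' : 'I_(size vs)) (e : edge n) :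
  i' != i -> edge_at (vtx i) e -> edge_at (vtx i') e = None.
Proof.
move=> ne ei; case E: edge_at => [f|] //.
have /(edge_at_unique ei)/vtx_inj ii' : edge_at (vtx i') e by rewrite E.
by rewrite ii' eqxx in ne.
Qed.

Definition siop_family (D : diagram n) (i : 'I_(size vs)) : Siop R (arity t (vtx i)) :=
  Siop_pi R _ (fm_gen R (diag_at (vtx i) D)).

Definition siop_tens D : Siop_tensor t vs R := tens (siop_family D).

Lemma Siop_tensor_pi_gen D :
  Siop_tensor_pi t vs R (g_map t vs R (fm_gen R D)) = siop_tens D.
Proof. by rewrite /= fm_lift_gen tensor_map_tens. Qed.

(* The next lemmas are chained with [etrans] and [congr2]: rewriting with them
   would have the unifier compare the multisets [e +` D] and [e' +` D], which
   diverges. *)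
Section FamilyAdd.
Variables (i : 'I_(size vs)) (D : diagram n) (e e' : edge n).
Local Notation Di := (diag_at (vtx i) D).

Lemma siop_family_in f : edge_at (vtx i) e = Some f ->
  siop_family (e +` D) i = Siop_pi R _ (fm_gen R (f +` Di)).
Proof. by move=> ef; rewrite /siop_family diag_atD ef. Qed.

Lemma siop_family_out : edge_at (vtx i) e = None ->
  siop_family (e +` D) i = siop_family D i.
Proof. by move=> ef; rewrite /siop_family diag_atD ef. Qed.

Lemma siop_family_in2 f f' :
  edge_at (vtx i) e = Some f -> edge_at (vtx i) e' = Some f' ->
  siop_family (e +` (e' +` D)) i = Siop_pi R _ (fm_gen R (f +` (f' +` Di))).
Proof.
move=> ef ef'; rewrite /siop_family diag_atD ef.
by congr (Siop_pi _ _ (fm_gen _ (_ +` _))); rewrite diag_atD ef'.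
Qed.

Lemma siop_family_in_out f :
  edge_at (vtx i) e = Some f -> edge_at (vtx i) e' = None ->
  siop_family (e +` (e' +` D)) i = Siop_pi R _ (fm_gen R (f +` Di)).
Proof.
move=> ef ef'; rewrite /siop_family diag_atD ef.
by congr (Siop_pi _ _ (fm_gen _ (_ +` _))); rewrite diag_atD ef'.
Qed.
End FamilyAdd.

(** The nadir depends only on the pair of ends, so both edges land in the same factor, again with
    common ends. *)
Lemma siop_tens_multiple (D : diagram n) (e e' : edge n) : same_ends e e' ->
  siop_tens (e +` (e' +` D)) = 0.
Proof.
have [v + ev] := edge_at_exists e => /vtx_exists [i vi] ee'; subst v.
case E: edge_at ev => [f|] // _; move: (E) => /edge_atP /andP [J1 J2].
have [f' ef' ff'] : exists2 f', edge_at (vtx i) e' = Some f' & same_ends f f'.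
  case/orP: ee' => /eqP ee'.
    by exists f; [apply/edge_atP; rewrite ee' J1 | rewrite /same_ends eqxx].
  have [|f' ef' f'E] := @edge_at_J t (vtx i) e' _ _ _ _ ee' J2 J1.
    by rewrite eq_sym (valP f).
  by exists f' => //; rewrite /same_ends f'E eqxx orbT.
apply: (@tens_eq0 _ _ _ _ i); apply: etrans (siop_family_in2 _ E ef') _.
exact/Siop_pi0/I_multiple.
Qed.

Lemma siop_tens_symmetry (D : diagram n) (e e' : edge n) :
  val e' = ((val e).2, (val e).1) -> siop_tens (e +` D) + siop_tens (e' +` D) = 0.
Proof.
have [v + ev] := edge_at_exists e => /vtx_exists [i vi] ee'; subst v.
case E: edge_at ev => [f|] // _; move: (E) => /edge_atP /andP [J1 J2].
have [|f' ef' f'E] := @edge_at_J t (vtx i) e' _ _ _ _ ee' J2 J1.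
  by rewrite eq_sym (valP f).
apply: (@tens_addN _ _ _ _ _ i) => [j ji|].
  apply: etrans (siop_family_out _ _) (esym (siop_family_out _ _)).
    by apply: (edge_at_None ji); rewrite ef'.
  by apply: (edge_at_None ji); rewrite E.
apply: etrans (congr2 +%R (siop_family_in _ E) (siop_family_in _ ef')) _.
by rewrite -linearD; apply/Siop_pi0/I_symmetry.
Qed.

Lemma siop_tens_grouped (D : diagram n) (i j k : 'I_n) (ij jk ki : edge n) v :
  val ij = (i, j) -> val jk = (j, k) -> val ki = (k, i) ->
  v \in internal t -> grouped i j k v ->
  siop_tens (ij +` (jk +` D)) + siop_tens (jk +` (ki +` D))
    + siop_tens (ki +` (ij +` D)) = 0.
Proof.
move=> ijE jkE kiE /vtx_exists [x ->] [a [b [ia ja kb ab]]].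
have ba : b != a by rewrite eq_sym.
have [f jkf fE] := edge_at_J jkE ja kb ab.
have [f' kif' f'E] := edge_at_J kiE kb ia ba.
have ijN := edge_at_same ijE ia ja.
have jk_ki0 : siop_tens (jk +` (ki +` D)) = 0.
  apply: (@tens_eq0 _ _ _ _ x); apply: etrans (siop_family_in2 _ jkf kif') _.
  by apply/Siop_pi0/I_multiple; rewrite /same_ends fE f'E eqxx orbT.
have add_mid0 (V : zmodType) (y y' z w : V) :
    y = y' -> z = 0 -> y' + w = 0 -> y + z + w = 0.
  by move=> -> ->; rewrite addr0.
(* Putting [jk] in front of [ij] makes the first term differ from the third only in its head edge,
   [jk] against [ki]. *)
apply: add_mid0 (congr1 siop_tens (msetDCA _ _ _)) jk_ki0 _.
apply: (@tens_addN _ _ _ _ _ x) => [y yx|].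
  apply: etrans (siop_family_out _ _) (esym (siop_family_out _ _)).
    by apply: (edge_at_None yx); rewrite kif'.
  by apply: (edge_at_None yx); rewrite jkf.
apply: etrans (congr2 +%R (siop_family_in_out _ jkf ijN)
                          (siop_family_in_out _ kif' ijN)) _.
by rewrite -linearD; apply/Siop_pi0/I_symmetry; rewrite fE f'E.
Qed.

Lemma siop_tens_three_way (D : diagram n) (i j k : 'I_n) (ij jk ki : edge n) v :
  val ij = (i, j) -> val jk = (j, k) -> val ki = (k, i) ->
  v \in internal t -> three_way i j k v ->
  siop_tens (ij +` (jk +` D)) + siop_tens (jk +` (ki +` D))
    + siop_tens (ki +` (ij +` D)) = 0.
Proof.
move=> ijE jkE kiE /vtx_exists [x ->] [a [b [c [ia jb kc]]]].
rewrite /= !inE negb_or andbT => /andP [/andP [ab ac] bc].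
rewrite eq_sym in ac.
have [f ijf fE] := edge_at_J ijE ia jb ab.
have [g jkg gE] := edge_at_J jkE jb kc bc.
have [h kih hE] := edge_at_J kiE kc ia ac.
(* All three edges have nadir [vtx x], so the other factors see [D] alone. *)
have out2 y e e' : y != x -> edge_at (vtx x) e -> edge_at (vtx x) e' ->
    siop_family (e +` (e' +` D)) y = siop_family D y.
  move=> yx ex ex'; apply: etrans (siop_family_out _ _) (siop_family_out _ _).
    exact: edge_at_None yx ex.
  exact: edge_at_None yx ex'.
have ijx : edge_at (vtx x) ij by rewrite ijf.
have jkx : edge_at (vtx x) jk by rewrite jkg.
have kix : edge_at (vtx x) ki by rewrite kih.
apply: (@tens_add3 _ _ _ _ _ _ x) => [y yx|y yx|].
- exact (etrans (out2 y _ _ yx jkx kix) (esym (out2 y _ _ yx ijx jkx))).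
- exact (etrans (out2 y _ _ yx kix ijx) (esym (out2 y _ _ yx ijx jkx))).
apply: etrans (congr2 +%R (congr2 +%R (siop_family_in2 _ ijf jkg)
  (siop_family_in2 _ jkg kih)) (siop_family_in2 _ kih ijf)) _.
by rewrite -!linearD; apply/Siop_pi0; apply: I_Arnold fE gE hE.
Qed.

Lemma Siop_tensor_pi_g_map0 x : I_rel x ->
  (Siop_tensor_pi t vs R \o g_map t vs R) x = 0.
Proof.
pose f : {linear Delta R n -> Siop_tensor t vs R} :=
  Siop_tensor_pi t vs R \o g_map t vs R.
have fE D : f (fm_gen R D) = siop_tens D := Siop_tensor_pi_gen D.
move=> Ix; rewrite -[LHS]/(f x); move: f fE Ix => f fE.
case=> [D i j k ij jk ki ijE jkE kiE|D e e' ee'|D e e' ee'].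
- rewrite !linearD; apply: etrans (congr2 +%R (congr2 +%R (fE _) (fE _)) (fE _)) _.
  have ij_ne : i != j by have := valP ij; rewrite ijE.
  have jk_ne : j != k by have := valP jk; rewrite jkE.
  have ki_ne : k != i by have := valP ki; rewrite kiE.
  have [v v_in [vg|vg|vg|vg]] := split_three ij_ne jk_ne ki_ne.
  + exact: siop_tens_three_way vg.
  + exact: siop_tens_grouped vg.
  (* Rotating the three terms reduces this case and the next to the first grouped one. *)
  + by rewrite -addrA addrC; apply: siop_tens_grouped vg.
  + by rewrite addrC addrA; apply: siop_tens_grouped vg.
- by rewrite linearD; apply: etrans (congr2 +%R (fE _) (fE _)) (siop_tens_symmetry _ _).
- by rewrite fE; apply: siop_tens_multiple.
Qed.
End Unordered.

(** * Ordered edges *)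

Lemma set2_eq (T : finType) (x y x' y' : T) :
  [set x; y] = [set x'; y'] -> x = x' /\ y = y' \/ x = y' /\ y = x'.
Proof.
move=> E; have: x \in [set x'; y'] by rewrite -E set21.
have: y \in [set x'; y'] by rewrite -E set22.
have: x' \in [set x; y] by rewrite E set21.
have: y' \in [set x; y] by rewrite E set22.
rewrite !inE => /orP [] /eqP ? /orP [] /eqP ? /orP [] /eqP ? /orP [] /eqP ?; subst; auto.
Qed.

Section OEdges.
Variable t : rptree.
Local Notation n := (nleaves t).

Lemma oedge_at_split v (e : oedge n) (f : oedge (arity t v)) :
  oedge_at v e = Some f -> exists j k a b,
    [/\ val e = [set j; k], val f = [set a; b], is_J j a, is_J k b & a != b].
Proof.
rewrite /oedge_at; case: pickP => // _ /[swap] -[->].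
case/existsP=> j /existsP [k /existsP [a /existsP [b]]].
case/and5P=> /eqP eE _ /eqP fE ja kb; exists j, k, a, b; split=> //.
by have := valP f; rewrite fE cards2; case: (a != b).
Qed.

Lemma oedge_at_J v (e : oedge n) (j k : 'I_n) (a b : 'I_(arity t v)) :
  val e = [set j; k] -> is_J j a -> is_J k b -> a != b ->
  exists2 f, oedge_at v e = Some f & val f = [set a; b].
Proof.
move=> eE ja kb ab; case E: (oedge_at v e) => [f|].
  exists f => //; have [j' [k' [a' [b' [e'E -> ja' kb' _]]]]] := oedge_at_split E.
  (* The ends may be matched in either order; both give the same set of branches. *)
  move: e'E; rewrite eE => /set2_eq [] [? ?]; subst j' k'.
    by rewrite (is_J_inj ja ja') (is_J_inj kb kb').
  by rewrite (is_J_inj ja kb') (is_J_inj kb ja') setUC.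
move: E; rewrite /oedge_at; case: pickP => // none _.
have ab2 : #|[set a; b]| == 2 by rewrite cards2 ab.
have /negP [] := negbT (none (exist _ [set a; b] ab2)); apply/existsP; exists j.
apply/existsP; exists k; apply/existsP; exists a; apply/existsP; exists b.
by rewrite eE ja kb !eqxx /= andbT; apply/asboolP/(split_nadir ja kb ab).
Qed.

Lemma oedge_at_unique v v' (e : oedge n) :
  oedge_at v e -> oedge_at v' e -> v = v'.
Proof.
case E: oedge_at => [f|] // _; case E': oedge_at => [f'|] // _.
have [j [k [a [b [eE _ ja kb ab]]]]] := oedge_at_split E.
have [j' [k' [a' [b' [e'E _ ja' kb' ab']]]]] := oedge_at_split E'.
move: e'E; rewrite eE => /set2_eq [] [? ?]; subst j' k'.
  exact: split_unique ja kb ab ja' kb' ab'.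
by apply: split_unique ja kb ab kb' ja' _; rewrite eq_sym.
Qed.

Lemma oedge_at_exists (e : oedge n) : exists2 v, v \in internal t & oedge_at v e.
Proof.
have /cards2P [j [k [jk eE]]] := valP e.
have [v v_in [a [b [ja kb ab]]]] := split_exists jk; exists v => //.
by have [f ->] := oedge_at_J eE ja kb ab.
Qed.

Lemma oedge_at_same v (e : oedge n) (j k : 'I_n) (a : 'I_(arity t v)) :
  val e = [set j; k] -> is_J j a -> is_J k a -> oedge_at v e = None.
Proof.
move=> eE ja ka; case E: oedge_at => [f|] //.
have [j' [k' [a' [b' [e'E _ ja' kb' ab']]]]] := oedge_at_split E.
move: e'E ab'; rewrite eE => /set2_eq [] [? ?]; subst j' k'.
  by rewrite -(is_J_inj ja ja') -(is_J_inj ka kb') eqxx.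
by rewrite -(is_J_inj ja kb') -(is_J_inj ka ja') eqxx.
Qed.
End OEdges.

(** * The relations and signs under the ordered map *)

Section Ordered.
Variables (R : comPzRingType) (t : rptree) (vs : seq address).
Hypothesis hvs : perm_eq vs (internal t).
Local Notation n := (nleaves t).
Local Notation vtx := (tnth (in_tuple vs)).

(** Numbering nadirs by their place in [vs] turns the order of the tensor factors into that of
    numbers, and a diagram into a word. *)
Definition nadir_index (e : oedge n) : nat := find (fun v => oedge_at v e) vs.

Lemma nadir_index_lt e : (nadir_index e < size vs)%N.
Proof.
rewrite -has_find; apply/hasP; have [v v_in ev] := oedge_at_exists e.
by exists v; rewrite ?(perm_mem hvs).
Qed.

Lemma nadir_index_ord e : exists i : 'I_(size vs), nadir_index e = i.
Proof. by move: (nadir_index e) (nadir_index_lt e) => k k_lt; exists (Ordinal k_lt). Qed.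

Lemma oedge_at_nadir_index e (i : 'I_(size vs)) :
  isSome (oedge_at (vtx i) e) = (nadir_index e == i).
Proof.
have e_at : oedge_at (nth [::] vs (nadir_index e)) e.
  by apply: (@nth_find _ [::] (fun v => isSome (oedge_at v e)));
    rewrite has_find nadir_index_lt.
apply/idP/eqP => [ei|ei]; last by rewrite (tnth_nth [::]) /= -ei.
apply/eqP; rewrite -(nth_uniq [::] _ (ltn_ord i)) ?nadir_index_lt //.
  by apply/eqP/(oedge_at_unique e_at); rewrite -(tnth_nth [::] (in_tuple vs)).
by rewrite (perm_uniq hvs); apply/filter_uniq/uniq_vertices.
Qed.

Lemma oedge_at_None (i : 'I_(size vs)) e :
  nadir_index e != i -> oedge_at (vtx i) e = None.
Proof. by rewrite -oedge_at_nadir_index; case: oedge_at. Qed.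

Lemma oedge_at_Some (i : 'I_(size vs)) e :
  nadir_index e = i -> exists f, oedge_at (vtx i) e = Some f.
Proof.
move=> /eqP; rewrite -oedge_at_nadir_index; move: (oedge_at _ e) => o.
by case: o => // f; exists f.
Qed.

Lemma concat_edgesE D : [seq val a | a <- concat_edges vs D] =
  color_sort (size vs) [seq nadir_index e | e <- D].
Proof.
rewrite /concat_edges /color_sort map_flatten -map_comp; congr flatten.
rewrite -{1}(mkseq_nth [::] vs) -map_comp; apply/eq_in_map => i.
rewrite mem_iota => i_lt /=.
rewrite /color_block size_map -val_enum_ord filter_map; congr map; apply: eq_filter => a /=.
rewrite (tnth_nth (tnth (in_tuple D) a)) /= (nth_map (tnth (in_tuple D) a)) ?ltn_ord //.
by rewrite -(oedge_at_nadir_index _ (Ordinal i_lt)) (tnth_nth [::]).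
Qed.

(** The [pick] in [concat_perm] succeeds, since [color_sort_perm] supplies a witness, and one-line
    notation determines the permutation; the default identity is never reached. *)
Lemma odd_concat_perm D :
  odd_perm (concat_perm vs D) = odd (inversions [seq nadir_index e | e <- D]).
Proof.
have [||p [pE <-]] := @color_sort_perm (size vs) (size D) [seq nadir_index e | e <- D].
- by rewrite size_map.
- by apply/allP => _ /mapP [e _ ->]; apply: nadir_index_lt.
have sortE (q : 'S_(size D)) : [seq q a | a <- enum 'I_(size D)] == concat_edges vs D ->
    forall a : 'I_(size D),
    nth 0%N (color_sort (size vs) [seq nadir_index e | e <- D]) a = q a.
  move=> /eqP qE a; rewrite -concat_edgesE -qE -map_comp (nth_map a) ?size_enum_ord //=.
  by rewrite nth_ord_enum.
rewrite /concat_perm; case: pickP => [q /sortE qE|/(_ p) /eqP []] /=.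
  by congr odd_perm; apply/permP => a; apply: val_inj; rewrite /= -qE -pE.
apply: (inj_map val_inj); rewrite concat_edgesE -map_comp.
apply: (@eq_from_nth _ 0%N) => [|a]; rewrite size_map size_enum_ord.
  rewrite size_color_sort -{1}(size_map nadir_index D); apply/esym/eqP.
  by rewrite -all_count; apply/allP => _ /mapP [e _ ->]; apply: nadir_index_lt.
move=> a_lt; rewrite (nth_map (Ordinal a_lt)) ?size_enum_ord //= -pE.
by rewrite nth_enum_ord.
Qed.

Definition osiop_family (D : odiagram n) (i : 'I_(size vs)) : oSiop R (arity t (vtx i)) :=
  oSiop_pi R _ (fm_gen R (odiag_at (vtx i) D)).

Definition osiop_tens D : oSiop_tensor t vs R :=
  (-1) ^+ odd (inversions [seq nadir_index e | e <- D]) *: tens (osiop_family D).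

Lemma oSiop_tensor_pi_gen D :
  oSiop_tensor_pi t vs R (og_map t vs R (fm_gen R D)) = osiop_tens D.
Proof. by rewrite /= fm_lift_gen linearZ /= tensor_map_tens odd_concat_perm. Qed.

Lemma osiop_tens_eq0 D i : ~~ uniq (odiag_at (vtx i) D) -> osiop_tens D = 0.
Proof.
move=> Ui; rewrite /osiop_tens (@tens_eq0 _ _ _ _ i) ?scaler0 //.
exact/oSiop_pi0/oI_multiple.
Qed.

(** A repeated edge is repeated in the factor of its nadir. *)
Lemma osiop_tens_multiple D : ~~ uniq D -> osiop_tens D = 0.
Proof.
move=> UD; suff [i Ui] : exists i, ~~ uniq (odiag_at (vtx i) D) by apply: osiop_tens_eq0 Ui.
elim: D UD => //= e D IHD; rewrite negb_and negbK => /orP [e_D|/IHD [i Ui]].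
  exists (Ordinal (nadir_index_lt e)).
  have := oedge_at_nadir_index e (Ordinal (nadir_index_lt e)); rewrite eqxx.
  rewrite /odiag_at /=; case E: oedge_at => [f|] //= _.
  by rewrite mem_pmap -E map_f.
exists i; rewrite /odiag_at /=; case: oedge_at => [f|] //=.
by rewrite negb_and [X in _ || X]Ui orbT.
Qed.

Lemma osiop_tensN (D D' : odiagram n) : osiop_family D = osiop_family D' ->
  odd (inversions [seq nadir_index e | e <- D]) =
    ~~ odd (inversions [seq nadir_index e | e <- D']) ->
  osiop_tens D = - osiop_tens D'.
Proof. by rewrite /osiop_tens => -> ->; rewrite signrN scaleNr. Qed.

Lemma osiop_family_in2 (i : 'I_(size vs)) (A B : odiagram n) (e e' : oedge n) f f' :
  oedge_at (vtx i) e = Some f -> oedge_at (vtx i) e' = Some f' ->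
  osiop_family (A ++ e :: e' :: B) i =
  oSiop_pi R _ (fm_gen R (odiag_at (vtx i) A ++ f :: f' :: odiag_at (vtx i) B)).
Proof. by move=> ef ef'; rewrite /osiop_family /odiag_at pmap_cat /= ef ef'. Qed.

Lemma osiop_family_comm (i : 'I_(size vs)) (A B : odiagram n) (e e' : oedge n) :
  oedge_at (vtx i) e = None ->
  osiop_family (A ++ e :: e' :: B) i = osiop_family (A ++ e' :: e :: B) i.
Proof. by move=> ei; rewrite /osiop_family /odiag_at !pmap_cat /= ei. Qed.

Lemma osiop_tens_swap A (e e' : oedge n) B :
  osiop_tens (A ++ e :: e' :: B) = - osiop_tens (A ++ e' :: e :: B).
Proof.
have [ee'|ee'] := eqVneq (nadir_index e) (nadir_index e'); last first.
  apply: osiop_tensN; last by rewrite !map_cat; apply: odd_inversions_swap ee'.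
  apply: functional_extensionality_dep => i.
  (* In each factor at least one of the two edges is missing, so their order is not seen. *)
  have [ei|ei] := eqVneq (nadir_index e) i.
    by apply/esym/osiop_family_comm/oedge_at_None; rewrite -ei eq_sym.
  exact/osiop_family_comm/oedge_at_None.
(* With a common nadir the word is unchanged; the sign comes from the factor holding both edges,
   where they are again consecutive. *)
have idx_eq : [seq nadir_index f | f <- A ++ e :: e' :: B] =
              [seq nadir_index f | f <- A ++ e' :: e :: B].
  by rewrite !map_cat /= ee'.
have [i ei] := nadir_index_ord e.
have [f ef] := oedge_at_Some ei; have [f' e'f'] := oedge_at_Some (etrans (esym ee') ei).
have tens0 : tens (osiop_family (A ++ e :: e' :: B)) +
             tens (osiop_family (A ++ e' :: e :: B)) = 0.
  apply: (@tens_addN _ _ _ _ _ i) => [j ji|].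
    by apply/osiop_family_comm/oedge_at_None; rewrite -ee' ei eq_sym.
  apply: etrans (congr2 +%R (osiop_family_in2 _ _ ef e'f')
                            (osiop_family_in2 _ _ e'f' ef)) _.
  by apply/eqP; rewrite addr_eq0; apply/eqP/oSiop_pi_swap.
move: tens0 => /eqP; rewrite addr_eq0 => /eqP tens0.
apply: etrans (congr2 *:%R (congr1 (fun s => (-1) ^+ odd (inversions s)) idx_eq) tens0) _.
by rewrite scalerN.
Qed.

Lemma osiop_tens_grouped A B (i j k : 'I_n) (ij jk ki : oedge n) v :
  val ij = [set i; j] -> val jk = [set j; k] -> val ki = [set k; i] ->
  v \in internal t -> grouped i j k v ->
  osiop_tens (A ++ ij :: jk :: B) + osiop_tens (A ++ jk :: ki :: B)
    + osiop_tens (A ++ ki :: ij :: B) = 0.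
Proof.
move=> ijE jkE kiE /(vtx_exists hvs) [x ->] [a [b [ia ja kb ab]]].
have ba : b != a by rewrite eq_sym.
have [f jkf fE] := oedge_at_J jkE ja kb ab.
have [f' kif f'E] := oedge_at_J kiE kb ia ba.
(* Without orientation [jk] and [ki] give the very same edge, so the middle term has a repeated edge
   in factor [x]. *)
have ff' : f' = f by apply: val_inj; rewrite fE f'E setUC.
rewrite {f' f'E}ff' in kif.
have ijN := oedge_at_same ijE ia ja.
have jkx : nadir_index jk = x by apply/eqP; rewrite -oedge_at_nadir_index jkf.
have kix : nadir_index ki = x by apply/eqP; rewrite -oedge_at_nadir_index kif.
have ijx : nadir_index ij != x by rewrite -oedge_at_nadir_index ijN.
rewrite [X in _ + X + _](@osiop_tens_eq0 _ x) ?addr0; last first.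
  rewrite /odiag_at pmap_cat /= jkf kif /= cat_uniq /= inE eqxx /=.
  by rewrite !andbF.
apply/eqP; rewrite addr_eq0; apply/eqP.
(* The index of [ij] stands before [x] in the first word and after it in the last, and differs from
   [x]. *)
apply: osiop_tensN; last by rewrite !map_cat /= jkx kix (odd_inversions_swap _ _ ijx).
apply: functional_extensionality_dep => y.
have [<-|xy] := eqVneq x y.
  by rewrite /osiop_family /odiag_at !pmap_cat /= ijN jkf kif.
have jkN : oedge_at (vtx y) jk = None by apply: oedge_at_None; rewrite jkx.
have kiN : oedge_at (vtx y) ki = None by apply: oedge_at_None; rewrite kix.
by rewrite /osiop_family /odiag_at !pmap_cat /= jkN kiN.
Qed.

Lemma osiop_tens_three_way A B (i j k : 'I_n) (ij jk ki : oedge n) v :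
  val ij = [set i; j] -> val jk = [set j; k] -> val ki = [set k; i] ->
  v \in internal t -> three_way i j k v ->
  osiop_tens (A ++ ij :: jk :: B) + osiop_tens (A ++ jk :: ki :: B)
    + osiop_tens (A ++ ki :: ij :: B) = 0.
Proof.
move=> ijE jkE kiE /(vtx_exists hvs) [x ->] [a [b [c [ia jb kc]]]].
rewrite /= !inE negb_or andbT => /andP [/andP [ab ac] bc].
rewrite eq_sym in ac.
have [f ijf fE] := oedge_at_J ijE ia jb ab.
have [g jkg gE] := oedge_at_J jkE jb kc bc.
have [h kih hE] := oedge_at_J kiE kc ia ac.
have ijx : nadir_index ij = x by apply/eqP; rewrite -oedge_at_nadir_index ijf.
have jkx : nadir_index jk = x by apply/eqP; rewrite -oedge_at_nadir_index jkg.
have kix : nadir_index ki = x by apply/eqP; rewrite -oedge_at_nadir_index kih.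
have off y e : y != x -> nadir_index e = x -> oedge_at (vtx y) e = None.
  by move=> yx ex; apply: oedge_at_None; rewrite ex eq_sym.
(* The three words of nadirs coincide, so the common sign factors out. *)
rewrite /osiop_tens !map_cat /= ijx jkx kix -!scalerDr.
rewrite (@tens_add3 _ _ _ _ _ _ x) ?scaler0 // => [y yx|y yx|].
- rewrite /osiop_family /odiag_at !pmap_cat /=.
  by rewrite (off y ij yx ijx) (off y jk yx jkx) (off y ki yx kix).
- rewrite /osiop_family /odiag_at !pmap_cat /=.
  by rewrite (off y ij yx ijx) (off y jk yx jkx) (off y ki yx kix).
apply: etrans (congr2 +%R (congr2 +%R (osiop_family_in2 _ _ ijf jkg)
                                     (osiop_family_in2 _ _ jkg kih))
                         (osiop_family_in2 _ _ kih ijf)) _.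
by rewrite -!linearD; apply/oSiop_pi0; apply: oI_Arnold fE gE hE.
Qed.

Lemma oSiop_tensor_pi_og_map0 x : oI_rel x ->
  (oSiop_tensor_pi t vs R \o og_map t vs R) x = 0.
Proof.
pose f : {linear oDelta R n -> oSiop_tensor t vs R} :=
  oSiop_tensor_pi t vs R \o og_map t vs R.
have fE D : f (fm_gen R D) = osiop_tens D := oSiop_tensor_pi_gen D.
move=> oIx; rewrite -[LHS]/(f x); move: f fE oIx => f fE.
case=> [A B i j k ij jk ki ijE jkE kiE|m D D' p Dp|D UD].
- rewrite !linearD; apply: etrans (congr2 +%R (congr2 +%R (fE _) (fE _)) (fE _)) _.
  have ij_ne : i != j by have := valP ij; rewrite ijE cards2; case: (i != j).
  have jk_ne : j != k by have := valP jk; rewrite jkE cards2; case: (j != k).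
  have ki_ne : k != i by have := valP ki; rewrite kiE cards2; case: (k != i).
  have [v v_in [vg|vg|vg|vg]] := split_three ij_ne jk_ne ki_ne.
  + exact: osiop_tens_three_way vg.
  + exact: osiop_tens_grouped vg.
  + by rewrite -addrA addrC; apply: osiop_tens_grouped vg.
  + by rewrite addrC addrA; apply: osiop_tens_grouped vg.
- suff E : osiop_tens D = (-1) ^+ p *: osiop_tens D'.
    by rewrite linearB linearZ; apply/eqP; rewrite subr_eq0; apply/eqP;
      apply: etrans (fE D) (etrans E (congr1 _ (esym (fE D')))).
  (* The empty diagram is treated apart, since the first edge of [D] serves as default value for
     [nth]. *)
  case: m D D' p Dp => [|m] D D' p Dp.
    by rewrite (tuple0 D) (tuple0 D') (_ : p = 1%g) ?odd_perm1 ?scale1r //; apply/permP => -[].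
  apply: (@alternating_perm _ _ _ _ osiop_tens_swap (tnth D ord0) _ p [::] D D');
    rewrite ?size_tuple //.
  by move=> a; rewrite -!tnth_nth.
by rewrite fE; apply: osiop_tens_multiple.
Qed.
End Ordered.

(** * The induced maps on the quotients *)

Theorem corollary6p9 (R : comPzRingType) (t : rptree) (vs : seq address)
    (hvs : perm_eq vs (internal t)) :
  (exists h : {linear Siop R (nleaves t) -> Siop_tensor t vs R},
     forall x : Delta R (nleaves t),
       h (Siop_pi R (nleaves t) x) = Siop_tensor_pi t vs R (g_map t vs R x)) /\
  (exists h : {linear oSiop R (nleaves t) -> oSiop_tensor t vs R},
     forall x : oDelta R (nleaves t),
       h (oSiop_pi R (nleaves t) x) = oSiop_tensor_pi t vs R (og_map t vs R x)).
Proof.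
split.
  exact: (quotm_factor_exists (Siop_tensor_pi_g_map0 hvs)).
exact: (quotm_factor_exists (oSiop_tensor_pi_og_map0 hvs)).
Qed.
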